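(* Let $n\ge 2$ be an integer, let $\mathcal{A}=M_n(\mathbb{C})$, and let $f\in\mathbb{C}\langle\mathcal{X}\rangle$ be a noncommutative polynomial which is neither an identity nor a central polynomial of $\mathcal{A}$. Then every trace zero matrix in $\mathcal{A}$ can be written as a sum of two matrices from $f(\mathcal{A})-f(\mathcal{A})$.
   Context: $\mathbb{C}\langle\mathcal{X}\rangle$ is the free unital associative algebra over $\mathbb{C}$ generated by $\mathcal{X}=\{X_1,X_2,\dots\}$; its elements are called (noncommutative) polynomials. For $f=f(X_1,\dots,X_m)$ and a $\mathbb{C}$-algebra $\mathcal{A}$, the image of $f$ is $f(\mathcal{A})=\{f(a_1,\dots,a_m)\mid a_1,\dots,a_m\in\mathcal{A}\}$. The polynomial $f$ is an identity of $\mathcal{A}$ if $f(\mathcal{A})=\{0\}$; it is a central polynomial for $\mathcal{A}$ if $f(\mathcal{A})$ is contained in the center of $\mathcal{A}$ but $f$ is not an identity of $\mathcal{A}$. Moreover, $f(\mathcal{A})-f(\mathcal{A})=\{s-t\mid s,t\in f(\mathcal{A})\}$. *)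

(* Defs.v *)
From HB Require Import structures.
From mathcomp Require Import all_boot all_order all_algebra.
From mathcomp Require Import finmap complex monalg.
From mathcomp Require Import boolp classical_sets reals.

Set Implicit Arguments.
Unset Strict Implicit.
Unset Printing Implicit Defensive.

Import GRing.Theory.
Local Open Scope ring_scope.
Local Open Scope classical_set_scope.

(* The free unital associative algebra K<X_0, X_1, ...> is the monoid algebra
   of the free monoid of words in the letters 0, 1, ... *)
Notation "{ 'ncpoly' K }" := {malg K[{fmonom nat}]}
  (at level 0, K at level 2, format "{ 'ncpoly'  K }") : type_scope.

Definition ncX (K : comNzRingType) (i : nat) : {ncpoly K} := << fmu i >>.

Section NCPoly.
Variables (K : comNzRingType) (A : algType K).
Implicit Types (f g : {ncpoly K}) (a b : nat -> A) (S T : set A).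

Definition word_eval a (w : {fmonom nat}) : A := \prod_(i <- w) a i.

(* The value of f at X_i := a i.  A polynomial in X_0, ..., X_(m-1) only
   depends on a 0, ..., a (m-1) (see [eq_nceval]), so that [ncimage f] is the
   set of all f(a_0, ..., a_(m-1)). *)
Definition nceval f a : A := mmap (in_alg A) (word_eval a) f.

Definition ncimage f : set A := range (nceval f).

Definition alg_center : set A := [set x | forall y, GRing.comm x y].

Definition nc_identity f : Prop := ncimage f = [set 0].

Definition nc_central f : Prop :=
  ncimage f `<=` alg_center /\ ~ nc_identity f.

Definition set_diff S T : set A := [set s - t | s in S & t in T].

Lemma eq_nceval m f a b :
    (forall w, w \in msupp f -> all (fun i => (i < m)%N) w) ->
    (forall i, (i < m)%N -> a i = b i) ->
  nceval f a = nceval f b.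
Proof.
move=> fm ab; rewrite /nceval !mmapE; apply: eq_big_seq => w /fm/allP wm.
by congr (_ * _); apply: eq_big_seq => i /wm/ab.
Qed.

Lemma word_eval_mmorphism a : mmorphism (word_eval a).
Proof.
by split=> [x y|]; rewrite /word_eval ?fm1 ?fmM ?big_cat ?big_nil.
Qed.

HB.instance Definition _ a :=
  isMultiplicative.Build {fmonom nat} A (word_eval a) (word_eval_mmorphism a).

Lemma ncevalX a i : nceval (ncX K i) a = a i.
Proof.
by rewrite /nceval mmapU /= scale1r mul1r /word_eval fmU big_seq1.
Qed.

Lemma ncevalD a f g : nceval (f + g) a = nceval f a + nceval g a.
Proof. exact: mmapD. Qed.

Lemma ncevalZ a c f : nceval (c *: f) a = c *: nceval f a.
Proof. by rewrite /nceval mmapZ mulr_algl. Qed.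

Lemma nceval1 a : nceval 1 a = 1.
Proof. exact: mmap1. Qed.

Lemma ncevalM a f g : nceval (f * g) a = nceval f a * nceval g a.
Proof.
have comm_in_alg h (m m' : {fmonom nat}) :
    GRing.comm (in_alg A h@_m) (word_eval a m').
  by rewrite /GRing.comm /= mulr_algl mulr_algr.
exact: (commr_mmap_is_multiplicative comm_in_alg).1.
Qed.

End NCPoly.

Arguments nceval {K} A f a.
Arguments ncimage {K} A f.
Arguments nc_identity {K} A f.
Arguments nc_central {K} A f.

(* Main.v *)
(* The values of [f] form a conjugation-invariant set, so it suffices to find
   one value [G], up to an affine change [s + t G], whose eigenvalues have
   multiplicity at most half the size, and to write every trace zero matrix
   as a signed sum of four conjugates of such a [G].

   To find [G], let [u] and [v] be the clock and shift matrices, so that the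
   [u^j v^k] span the matrix algebra.  Replacing [u^j v^k] by
   [x^(j + N k) u^j v^k] with [N] large turns a non-scalar value [f(a)] into
   a polynomial in [x] whose coefficients are multiples of single [u^j v^k].
   Up to scalars, its lowest non-scalar term dominates near [x = 0].  A
   non-scalar [T = u^j v^k] is similar to [zeta T] for some [zeta <> 1], so its
   eigenvalues come in pairs [x <> zeta x] of equal multiplicity; the bound on
   the multiplicities is an open condition, hence holds for a small [x <> 0].

   For such a [G], group the eigenvalues into three disjoint packets, none
   larger than the two others together, so that [G] is similar to
   [T = diag (T1, T2, T3)] and, by Sylvester's equation, to every block
   triangular matrix with these diagonal blocks.  A difference of an upper and
   a lower one has arbitrary off-diagonal blocks, so that only the diagonal
   blocks of a matrix [b] with zero diagonal, similar to the given one, have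
   to be matched.  Conjugating upper block triangular matrices by lower block
   unitriangular ones adds [- X Z], [Z2 X2], [Z3 X3] to the diagonal blocks of
   [T], and [X Z] can be any matrix similar to a prescribed overlap of [Z2 X2]
   and [Z3 X3]; splitting the blocks of [b] into triangular parts with
   distinct diagonal entries makes all these similarities automatic. *)
Require Import Defs.
From mathcomp Require Import all_boot all_order all_algebra all_field.
From mathcomp Require Import finmap complex monalg.
From mathcomp Require Import boolp classical_sets reals.
From mathcomp Require Import zify.

Set Implicit Arguments.
Unset Strict Implicit.
Unset Printing Implicit Defensive.

Import GRing.Theory.
Local Open Scope ring_scope.
Local Open Scope classical_set_scope.

(** * Similarity *)

Definition similar_mx (F : fieldType) n (A B : 'M[F]_n) :=
  exists2 S, S \in unitmx & S *m A = B *m S.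

Section Similarity.
Variable F : fieldType.

Lemma similar_refl n (A : 'M[F]_n) : similar_mx A A.
Proof. by exists 1%:M; rewrite ?unitmx1 // mul1mx mulmx1. Qed.

Lemma similar_sym n (A B : 'M[F]_n) : similar_mx A B -> similar_mx B A.
Proof.
case=> S uS SA; exists (invmx S); rewrite ?unitmx_inv //.
by rewrite -[RHS](mulKmx uS) [S *m _]mulmxA SA mulmxK.
Qed.

Lemma similar_trans n (B A C : 'M[F]_n) :
  similar_mx A B -> similar_mx B C -> similar_mx A C.
Proof.
case=> S uS SA [S' uS' SB]; exists (S' *m S); first by rewrite unitmx_mul uS'.
by rewrite -mulmxA SA mulmxA SB mulmxA.
Qed.

Lemma similar_tr n (A B : 'M[F]_n) : similar_mx A B -> similar_mx A^T B^T.
Proof.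
move=> /similar_sym[S uS SA]; exists S^T; first by rewrite unitmx_tr.
by rewrite -!trmx_mul SA.
Qed.

Lemma similar_conj n (S A : 'M[F]_n) :
  S \in unitmx -> similar_mx A (S *m A *m invmx S).
Proof. by move=> uS; exists S; rewrite // mulmxKV. Qed.

(** The change of basis is block diagonal, so an off-diagonal block is only multiplied by invertible
    matrices and stays zero if it was zero. *)
Lemma similar_block m n (A C : 'M[F]_m) (B D : 'M[F]_n) W X :
    similar_mx A C -> similar_mx B D ->
  exists Z Y, [/\ similar_mx (block_mx A W X B) (block_mx C Z Y D),
                   W = 0 -> Z = 0 & X = 0 -> Y = 0].
Proof.
case=> S uS SA [S' uS' SB].
exists (S *m W *m invmx S'), (S' *m X *m invmx S).
split=> [|->|->]; rewrite ?mulmx0 ?mul0mx //; exists (block_mx S 0 0 S').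
  by rewrite unitmxE det_lblock unitrM -!unitmxE uS.
rewrite !mulmx_block !mulmx0 !mul0mx !addr0 !add0r SA SB.
by rewrite !mulmxKV.
Qed.

Lemma similar_block_diag m n (A C : 'M[F]_m) (B D : 'M[F]_n) :
    similar_mx A C -> similar_mx B D ->
  similar_mx (block_mx A 0 0 B) (block_mx C 0 0 D).
Proof.
move=> AC BD; have [Z [Y [sZY Z0 Y0]]] := similar_block 0 0 AC BD.
by rewrite Z0 // Y0 in sZY.
Qed.

Lemma similar_char_poly n (A B : 'M[F]_n) :
  similar_mx A B -> char_poly A = char_poly B.
Proof.
case=> S uS SA; rewrite /char_poly /char_poly_mx.
have: map_mx polyC S *m ('X%:M - map_mx polyC A) =
      ('X%:M - map_mx polyC B) *m map_mx polyC S.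
  by rewrite mulmxBr mulmxBl -!map_mxM SA scalar_mxC.
move/(congr1 determinant); rewrite !det_mulmx mulrC; apply: mulIf.
by rewrite det_map_mx polyC_eq0 -unitfE -unitmxE.
Qed.

Lemma similar_trace n (A B : 'M[F]_n) : similar_mx A B -> \tr A = \tr B.
Proof.
case=> S uS SA; rewrite -[A](mulKmx uS) SA mulmxA mxtrace_mulC.
by rewrite mulmxA mulmxV // mul1mx.
Qed.

Lemma char_poly_lblock m n (A : 'M[F]_m) (B : 'M[F]_n) X :
  char_poly (block_mx A 0 X B) = char_poly A * char_poly B.
Proof.
rewrite /char_poly /char_poly_mx map_block_mx map_mx0 scalar_mx_block.
by rewrite opp_block_mx add_block_mx subr0 det_lblock.
Qed.

(** In the rank factorization of the row [v] the left factor is a nonzero scalar [c], so [v] is [c]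
    times the first row of the invertible [row_ebase v]. *)
Lemma unitmx_extension n (v : 'rV[F]_(1 + n)) :
  v != 0 -> exists2 S, S \in unitmx & usubmx S = v.
Proof.
move=> v0; pose c := col_ebase v 0 0.
have c0 : c != 0.
  have := col_ebase_unit v.
  by rewrite unitmxE [col_ebase v]mx11_scalar det_scalar1 unitfE.
exists (c *: row_ebase v); first by rewrite unitmxZ ?unitfE ?row_ebase_unit.
rewrite -[RHS]mulmx_ebase rank_rV v0 [col_ebase v]mx11_scalar -mulmxA.
rewrite mul_scalar_mx -/c linearZ /=; congr (_ *: _).
rewrite -{2}[row_ebase v]vsubmxK pid_mx_row mul_row_col mul1mx mul0mx.
by rewrite addr0.
Qed.

Lemma similar_eigen n (A : 'M[F]_(1 + n)) x :
  root (char_poly A) x -> exists c A', similar_mx A (block_mx x%:M 0 c A').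
Proof.
rewrite -eigenvalue_root_char => /eigenvalueP[v vA v0].
have [S uS Sv] := unitmx_extension v0.
pose B := S *m A *m invmx S.
exists (dlsubmx B), (drsubmx B).
suff e : usubmx B = row_mx x%:M 0.
  have -> : block_mx x%:M 0 (dlsubmx B) (drsubmx B) = B.
    by rewrite -[RHS]submxK /block_mx -e /ulsubmx /ursubmx hsubmxK.
  exact: similar_conj.
rewrite /B -!mul_usub_mx Sv vA -Sv -scalemxAl mul_usub_mx mulmxV //.
by rewrite scalar_mx_block block_mxEv col_mxKu scale_row_mx scaler0
           scale_scalar_mx mulr1.
Qed.

End Similarity.

(** * Triangular forms and Sylvester's equation *)

Section Triangular.
Variable F : fieldType.

(** Left eigenvectors split off one eigenvalue at a time, in the order of [t]; this control of the
    order later allows eigenvalues to be grouped. *)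
Lemma similar_trig n (A : 'M[F]_n) t :
    char_poly A = \prod_(x <- t) ('X - x%:P) ->
  exists L, [/\ similar_mx A L, is_trig_mx L & forall i, L i i = t`_i].
Proof.
elim: n A t => [|n IHn] A t At.
  exists A; split; first exact: similar_refl; last by case.
  by apply/is_trig_mxP; case.
case: t At => [|x t] At.
  by have := size_char_poly A; rewrite At big_nil size_poly1.
have [|c [A' sA]] := @similar_eigen F n A x.
  by rewrite At big_cons rootM root_XsubC eqxx.
have [|L [sL tL dL]] := IHn A' t.
  apply: (@mulfI _ ('X - x%:P)); first by rewrite polyXsubC_eq0.
  rewrite -[RHS](big_cons _ _ _ _ xpredT (fun x => 'X - x%:P)) -At.
  rewrite (similar_char_poly sA) char_poly_lblock; congr (_ * _).
  by rewrite char_poly_trig ?mx11_is_trig // big_ord1 mxE eqxx.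
have [Z [Y [sY /(_ erefl) Z0 _]]] :=
  similar_block 0 c (similar_refl x%:M) sL.
rewrite {}Z0 in sY.
exists (block_mx x%:M 0 Y L); split; first exact: similar_trans sA sY.
  have -> // := @is_trig_block_mx _ 1 n 1 n x%:M 0 Y L (erefl _).
  by rewrite eqxx mx11_is_trig.
move=> i; case: (@split_ordP 1 n i) => j ->.
  by rewrite (block_mxEul _ _ _ _ j j) ord1 mxE eqxx.
by transitivity (L j j); [exact: block_mxEdr | rewrite dL].
Qed.

Lemma horner_mx_intertwine m n (A : 'M[F]_m.+1) (B : 'M[F]_n.+1) Y p :
  B *m Y = Y *m A -> horner_mx B p *m Y = Y *m horner_mx A p.
Proof.
move=> BY; elim/poly_ind: p => [|p c IHp];
  first by rewrite !rmorph0 mul0mx mulmx0.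
rewrite !rmorphD !rmorphM /= !horner_mx_X !horner_mx_C mulmxDl mulmxDr.
by rewrite -!mulmxE -mulmxA BY mulmxA IHp -!mulmxA scalar_mxC.
Qed.

(** A Bezout relation evaluated at [B] makes the characteristic polynomial of [A] invertible at [B];
    moved across [Y], it is evaluated at [A] and vanishes by Cayley-Hamilton. *)
Lemma sylvester_inj m n (A : 'M[F]_m) (B : 'M[F]_n) Y :
  coprimep (char_poly A) (char_poly B) -> B *m Y = Y *m A -> Y = 0.
Proof.
case: m A Y => [|m] A Y; first by rewrite [Y]thinmx0.
case: n B Y => [|n] B Y; first by rewrite [Y]flatmx0.
move=> /Bezout_eq1_coprimepP[[u v] /= uv] BY.
have /(congr1 (fun M => M *m Y)) := congr1 (horner_mx B) uv.
rewrite rmorphD !rmorphM /= Cayley_Hamilton mulr0 addr0 rmorph1 mul1mx.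
rewrite -mulmxE -mulmxA (horner_mx_intertwine _ BY).
by rewrite Cayley_Hamilton !mulmx0.
Qed.

(** The Sylvester operator is an injective endomorphism of a finite-dimensional space, hence
    surjective. *)
Lemma sylvester_surj m n (A : 'M[F]_m) (B : 'M[F]_n) C :
    coprimep (char_poly A) (char_poly B) ->
  exists Y, B *m Y - Y *m A = C.
Proof.
move=> cAB; pose L := lin_mulmx B - lin_mulmxr A : 'M_(n * m).
have LE Y : mxvec Y *m L = mxvec (B *m Y - Y *m A).
  by rewrite mulmxBr !mul_vec_lin /= linearB.
have uL : L \in unitmx.
  rewrite -row_free_unit; apply: inj_row_free => v.
  rewrite -[v]vec_mxK LE => /eqP; rewrite mxvec_eq0 subr_eq0 => /eqP.
  by move/(sylvester_inj cAB) ->; rewrite linear0.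
exists (vec_mx (mxvec C *m invmx L)); apply: (can_inj mxvecK).
by rewrite -LE vec_mxK mulmxKV.
Qed.

(** Conjugating by a block unitriangular matrix with corner [Y] changes the corner by
    [B *m Y - Y *m A], which can be any [X]. *)
Lemma similar_lblock m n (A : 'M[F]_m) (B : 'M[F]_n) X :
    coprimep (char_poly A) (char_poly B) ->
  similar_mx (block_mx A 0 X B) (block_mx A 0 0 B).
Proof.
move=> /(sylvester_surj X)[Y YX]; exists (block_mx 1%:M 0 Y 1%:M).
  by rewrite unitmxE det_lblock !det1 mulr1 unitr1.
rewrite !mulmx_block !mul1mx !mulmx1 !mul0mx !mulmx0 !add0r !addr0.
by rewrite -YX addrC subrK.
Qed.

Lemma coprimep_char_poly_trig m n (A : 'M[F]_m) (B : 'M[F]_n) :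
    is_trig_mx A -> is_trig_mx B -> (forall i j, A i i != B j j) ->
  coprimep (char_poly A) (char_poly B).
Proof.
move=> tA tB AB; rewrite !char_poly_trig //.
apply: (big_ind (fun p => coprimep p _)) => [|p q cp cq|i _].
- exact: coprime1p.
- by rewrite coprimepMl cp.
apply: (big_ind (fun p => coprimep _ p)) => [|p q cp cq|j _].
- exact: coprimep1.
- by rewrite coprimepMr cp.
by rewrite coprimep_XsubC root_XsubC eq_sym.
Qed.

Lemma similar_trig_diag n (A : 'M[F]_n) :
    is_trig_mx A -> injective (fun i => A i i) ->
  similar_mx A (diag_mx (\row_i A i i)).
Proof.
elim/trigsqmx_ind: A / => [|{}n x c A tA IHA] inj;
  first by rewrite [diag_mx _]flatmx0; exact: similar_refl.
set B := block_mx x 0 c A.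
have d0 : B (lshift n 0) (lshift n 0) = x 0 0 by rewrite /B block_mxEul.
have dS i : B (rshift 1 i) (rshift 1 i) = A i i by rewrite /B block_mxEdr.
have -> : diag_mx (\row_i B i i) = block_mx x 0 0 (diag_mx (\row_i A i i)).
  clearbody B; rewrite -[LHS]submxK; congr block_mx; apply/matrixP=> i j;
    rewrite !mxE.
  - by rewrite !ord1 d0.
  - by rewrite eq_lrshift.
  - by rewrite eq_rlshift.
  - by rewrite dS.
apply: (@similar_trans _ _ (block_mx x 0 0 A)).
  apply/similar_lblock/coprimep_char_poly_trig; rewrite ?mx11_is_trig //.
  move=> i j; rewrite !ord1 -dS -d0; apply/negP=> /eqP/inj/(congr1 val).
  by [].
apply: similar_block_diag (similar_refl x) (IHA _).
by move=> i j e; apply: (@rshift_inj 1); apply: inj; rewrite !dS.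
Qed.

End Triangular.

(** * Similarity to a matrix with zero diagonal *)

Section ZeroDiagonal.
Variable F : fieldType.

Lemma similar_trig2 n (A B : 'M[F]_n) :
    is_trig_mx A -> is_trig_mx B -> (forall i, A i i = B i i) ->
  injective (fun i => A i i) -> similar_mx A B.
Proof.
move=> tA tB AB injA; apply: similar_trans (similar_trig_diag tA injA) _.
have -> : \row_i A i i = \row_i B i i by apply/rowP=> i; rewrite !mxE.
apply/similar_sym/similar_trig_diag => // i j.
by rewrite -!AB => /injA.
Qed.

(** Since [v *m w = 1], some invertible matrix has first row [v] while its inverse has first column
    [w]. *)
Lemma similar_entry0 n (B : 'M[F]_(1 + n)) (v : 'rV_(1 + n)) (w : 'cV_(1 + n)) :
    v *m w = 1%:M ->
  exists2 B', similar_mx B B' & ulsubmx B' = v *m B *m w.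
Proof.
move=> vw.
have w0 : w^T != 0.
  apply/eqP=> /(congr1 trmx); rewrite trmxK trmx0 => w0.
  by move/matrixP/(_ 0 0)/eqP: vw; rewrite w0 mulmx0 !mxE eq_sym oner_eq0.
have [S uS Sw] := unitmx_extension w0.
have uSt : S^T \in unitmx by rewrite unitmx_tr.
pose S0 := invmx S^T.
have S0w : S0 *m w = col_mx 1%:M 0.
  rewrite -[w]trmxK -Sw trmx_usub mulmx_lsub mulVmx //.
  by rewrite scalar_mx_block block_mxEh row_mxKl.
have S0V : invmx S0 *m col_mx 1%:M 0 = w.
  by rewrite -S0w mulKmx // unitmx_inv.
pose y := rsubmx (v *m invmx S0).
have vS0 : v *m invmx S0 = row_mx 1%:M y.
  rewrite -[LHS]hsubmxK; congr row_mx.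
  by rewrite -vw -S0V mulmxA -[v *m _ in RHS]hsubmxK mul_row_col mulmx1
             mulmx0 addr0.
(* [P] fixes the first unit column, to which [S0] sends [w], and turns the first row of [S0] into
   [v]. *)
pose P := block_mx 1%:M y 0 1%:M.
have uP : P \in unitmx by rewrite unitmxE det_ublock !det1 mulr1 unitr1.
have uS0 : S0 \in unitmx by rewrite unitmx_inv.
have uPS : P *m S0 \in unitmx by rewrite unitmx_mul uP.
have Pv : usubmx (P *m S0) = v.
  by rewrite -mul_usub_mx /P block_mxEv col_mxKu -vS0 mulmxKV.
have Pw : lsubmx (invmx (P *m S0)) = w.
  have Pw1 : P *m S0 *m w = col_mx 1%:M 0.
    by rewrite -mulmxA S0w mul_block_col !mul1mx !mulmx0 !mul0mx !addr0.
  rewrite -[LHS]mulmx1 -[w](mulKmx uPS) Pw1.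
  rewrite -{2}[invmx _]hsubmxK mul_row_col mulmx0 addr0 //.
exists ((P *m S0) *m B *m invmx (P *m S0)); first exact: similar_conj.
by rewrite /ulsubmx -[in RHS]Pv -[in RHS]Pw mulmx_lsub !mul_usub_mx.
Qed.

Lemma similar_zero_diag n (B : 'M[F]_n) :
    [pchar F] =i pred0 -> \tr B = 0 ->
  exists2 b, similar_mx B b & forall i, b i i = 0.
Proof.
move=> ch; elim: n B => [|n IHn] B trB.
  by exists B => [|[]//]; apply: similar_refl.
have [B' sB B'0] : exists2 B' : 'M_(1 + n), similar_mx B B' & ulsubmx B' = 0.
  have vw0 (v : 'rV_(1 + n)) (w : 'cV_(1 + n)) :
      v *m w = 1%:M -> v *m B *m w = 0 ->
      exists2 B' : 'M_(1 + n), similar_mx B B' & ulsubmx B' = 0.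
    by move=> vw <-; apply: similar_entry0.
  pose e (i : 'I_(1 + n)) : 'rV[F]_(1 + n) := delta_mx 0 i;
    pose e' (i : 'I_(1 + n)) : 'cV[F]_(1 + n) := delta_mx i 0.
  have eBe i j : e i *m B *m e' j = (B i j)%:M.
    by rewrite -rowE -colE; apply/matrixP=> a b; rewrite !ord1 !mxE.
  have ee i j : e i *m e' j = if i == j then 1%:M else 0.
    rewrite mul_delta_mx_cond; apply/matrixP=> a b.
    by rewrite !ord1; case: (i == j); rewrite !mxE ?eqxx.
  have [/existsP[i0 /existsP[j0 /andP[ij Bij]]]|/existsPn offd] :=
     boolP [exists i, exists j, (i != j) && (B i j != 0)].
    (* The multiple of [e' j0] leaves the product with [e i0] equal to 1 and, as [B i0 j0 != 0],
       cancels [B i0 i0]. *)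
    apply: (vw0 (e i0) (e' i0 - (B i0 i0 / B i0 j0) *: e' j0)).
      by rewrite mulmxBr -scalemxAr !ee eqxx (negPf ij) scaler0 subr0.
    rewrite mulmxBr -scalemxAr !eBe -mul_scalar_mx -scalar_mxM divfK //.
    by rewrite subrr.
  have {}offd i j : i != j -> B i j = 0.
    move=> ij; have /existsPn/(_ j) := offd i.
    by rewrite ij /= negbK => /eqP.
  have [/existsP[i /existsP[j Bij]]|/existsPn eqd] :=
     boolP [exists i, exists j, B i i != B j j].
    have ij : i != j by apply: contraNneq Bij => ->.
    have d0 : B i i - B j j != 0 by rewrite subr_eq0.
    (* Here [B] is diagonal; the weights solve [x + y = 1] and [x * B i i + y * B j j = 0]. *)
    apply: (vw0 (e i + e j)
      (- (B j j / (B i i - B j j)) *: e' i +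
       (B i i / (B i i - B j j)) *: e' j)).
      rewrite mulmxDr !mulmxDl -!scalemxAr !ee !eqxx eq_sym (negPf ij).
      rewrite !scaler0 addr0 add0r -scalerDl scale_scalar_mx mulr1.
      by rewrite addrC -mulNr -mulrDl divff.
    rewrite mulmxDr !mulmxDl -!scalemxAr !eBe (offd i j) //
      (offd j i) 1?eq_sym //.
    rewrite !raddf0 !addr0 !add0r !scale_scalar_mx -raddfD /=.
    by rewrite mulNr mulrAC [B i i / _ * _]mulrAC [B j j * _]mulrC addNr raddf0.
  (* What remains is a scalar [B]; trace zero and characteristic zero make it vanish. *)
  exists B; first exact: similar_refl.
  have Beq i : B i i = B 0 0 by have /existsPn/(_ 0) := eqd i;
    rewrite negbK => /eqP.
  move: trB; rewrite /mxtrace (eq_bigr (fun=> B 0 0)) // sumr_const card_ord.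
  move/eqP; rewrite -mulr_natr mulf_eq0 (pcharf0P _).1 // orbF => /eqP B0.
  by apply/matrixP=> a b; rewrite !ord1 !mxE Beq B0.
have trB' : \tr (drsubmx B') = 0.
  have := mxtrace_block (ulsubmx B') (ursubmx B') (dlsubmx B') (drsubmx B').
  by rewrite submxK B'0 mxtrace0 add0r => <-; rewrite -trB (similar_trace sB).
have [b sb b0] := IHn _ trB'.
have [Z [Y [sZY _ _]]] :=
  similar_block (ursubmx B') (dlsubmx B') (similar_refl 0) sb.
exists (block_mx 0 Z Y b).
  by apply: similar_trans sB _; rewrite -[B']submxK B'0.
move=> i; case: (@split_ordP 1 n i) => j ->.
  by transitivity ((0 : 'M[F]_1) j j); [exact: block_mxEul | rewrite mxE].
by transitivity (b j j); [exact: block_mxEdr | rewrite b0].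
Qed.

End ZeroDiagonal.

(** * Block triangular matrices with disjoint spectra *)

Section ThreeBlocks.
Variable F : fieldType.

Lemma char_poly_tr n (A : 'M[F]_n) : char_poly A^T = char_poly A.
Proof.
rewrite /char_poly -[RHS]det_tr /char_poly_mx; congr (\det _).
by rewrite linearB /= tr_scalar_mx map_trmx.
Qed.

Definition diag3_mx p q r (T1 : 'M[F]_p) (T2 : 'M_q) (T3 : 'M_r) :=
  block_mx T1 0 0 (block_mx T2 0 0 T3).

Lemma similar_lblock3 p q r (T1 : 'M[F]_p) (T2 : 'M_q) (T3 : 'M_r) X Y :
    coprimep (char_poly T1) (char_poly T2) ->
    coprimep (char_poly T1) (char_poly T3) ->
    coprimep (char_poly T2) (char_poly T3) ->
  similar_mx (diag3_mx T1 T2 T3) (block_mx T1 0 X (block_mx T2 0 Y T3)).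
Proof.
move=> c12 c13 c23; apply/similar_sym.
apply: (@similar_trans _ _ (block_mx T1 0 0 (block_mx T2 0 Y T3))).
  by apply: similar_lblock; rewrite char_poly_lblock coprimepMr c12.
by apply/similar_block_diag/similar_lblock => //; apply: similar_refl.
Qed.

Lemma similar_ublock3 p q r (T1 : 'M[F]_p) (T2 : 'M_q) (T3 : 'M_r) X Y :
    coprimep (char_poly T1) (char_poly T2) ->
    coprimep (char_poly T1) (char_poly T3) ->
    coprimep (char_poly T2) (char_poly T3) ->
  similar_mx (diag3_mx T1 T2 T3) (block_mx T1 X 0 (block_mx T2 Y 0 T3)).
Proof.
move=> c12 c13 c23.
have := @similar_lblock3 _ _ _ T1^T T2^T T3^T X^T Y^T.
rewrite !char_poly_tr => /(_ c12 c13 c23)/similar_tr.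
by rewrite /diag3_mx !tr_block_mx !trmx0 !trmxK.
Qed.

(* Conjugating the block upper triangular perturbation by a lower unitriangular
   matrix moves the diagonal blocks by [- X Z] and [Z X]. *)
Lemma similar_diag3_shift p q r (T1 : 'M[F]_p) (T2 : 'M_q) (T3 : 'M_r)
    (M : 'M_p) (N2 : 'M_q) (N3 : 'M_r) (E2 : 'M_(p, q)) (E3 : 'M_(p, r)) :
    coprimep (char_poly T1) (char_poly T2) ->
    coprimep (char_poly T1) (char_poly T3) ->
    coprimep (char_poly T2) (char_poly T3) ->
    E2^T *m E2 = 1%:M -> E3^T *m E3 = 1%:M ->
    similar_mx (E2 *m N2 *m E2^T + E3 *m N3 *m E3^T) M ->
  exists W X Y Z, similar_mx (diag3_mx T1 T2 T3)
    (block_mx (T1 - M) W X (block_mx (T2 + N2) Y Z (T3 + N3))).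
Proof.
move=> c12 c13 c23 E21 E31 [S uS SM].
(* As [E2^T] and [E3^T] are left inverses of [E2] and [E3], this factorization gives [X *m Z = M],
   while [Z *m X] has diagonal blocks [N2] and [N3]. *)
pose X := S *m row_mx E2 E3.
pose Z := col_mx (N2 *m E2^T) (N3 *m E3^T) *m invmx S.
have XZ : X *m Z = M.
  by rewrite /X /Z !mulmxA -[S *m _ *m _]mulmxA mul_row_col !mulmxA SM mulmxK.
have ZX : Z *m X = block_mx N2 (N2 *m E2^T *m E3) (N3 *m E3^T *m E2) N3.
  rewrite /X /Z mulmxA mulmxKV // mul_col_row.
  by rewrite -[N2 *m _ *m E2]mulmxA E21 -[N3 *m _ *m E3]mulmxA E31 !mulmx1.
pose T23 := block_mx T2 0 0 T3.
(* The lower left block forced by conjugation with the unitriangular matrix of corner [Z]. *)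
pose W := Z *m T1 - (Z *m X + T23) *m Z.
exists X, W, (N2 *m E2^T *m E3), (N3 *m E3^T *m E2).
apply: similar_trans (similar_ublock3 X 0 c12 c13 c23) _.
exists (block_mx 1%:M 0 Z 1%:M).
  by rewrite unitmxE det_lblock !det1 mulr1 unitr1.
have <- : Z *m X + T23 =
    block_mx (T2 + N2) (N2 *m E2^T *m E3) (N3 *m E3^T *m E2) (T3 + N3).
  by rewrite ZX add_block_mx !addr0 ![N2 + _]addrC [N3 + _]addrC.
rewrite !mulmx_block !mul1mx !mulmx1 !mul0mx !mulmx0 !add0r !addr0 -/T23 XZ.
by rewrite subrK [W + _]subrK.
Qed.

(** The common diagonal [d] cancels in the difference, so it can be prescribed freely; distinct
    values will make both triangular parts diagonalizable. *)
Lemma zero_diag_split n (b : 'M[F]_n) (d : 'I_n -> F) :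
    (forall i, b i i = 0) ->
  exists N N', [/\ b = N - N', is_trig_mx N, is_trig_mx N'^T,
                   forall i, N i i = d i & forall i, N' i i = d i].
Proof.
move=> b0.
exists (\matrix_(i, j) (if (j < i)%N then b i j else (d i) *+ (i == j))).
exists (\matrix_(i, j) (if (i < j)%N then - b i j else (d i) *+ (i == j))).
split.
- apply/matrixP=> i j; rewrite !mxE; rewrite -val_eqE /=;
    case: (ltngtP i j) => [ij|ij|/val_inj ->].
  + by rewrite mulr0n sub0r opprK.
  + by rewrite mulr0n subr0.
  + by rewrite subrr b0.
- apply/is_trig_mxP=> i j ij.
  by rewrite mxE ltnNge ltnW //= -val_eqE ltn_eqF //= mulr0n.
- apply/is_trig_mxP=> i j ij.
  by rewrite 2!mxE ltnNge ltnW //= -val_eqE gtn_eqF //= mulr0n.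
- by move=> i; rewrite mxE ltnn eqxx.
- by move=> i; rewrite mxE ltnn eqxx.
Qed.

(** The coordinate inclusion along [phi]: [E *m N *m E^T] places [N] on the rows and columns in the
    image of [phi], with zeros elsewhere. *)
Definition embed_mx q p (phi : 'I_q -> 'I_p) : 'M[F]_(p, q) :=
  \matrix_(i, j) (i == phi j)%:R.

Section Embed.
Variables (q p : nat) (phi : 'I_q -> 'I_p).
Hypothesis phi_mono : {mono phi : i j / (i < j)%N}.
Local Notation E := (embed_mx phi).

Lemma embed_inj : injective phi.
Proof.
move=> i j ij; case: (ltngtP i j) => [||/val_inj //];
  by rewrite -phi_mono ij ltnn.
Qed.

Lemma embed_mxK : E^T *m E = 1%:M.
Proof.
apply/matrixP=> i j; rewrite !mxE (bigD1 (phi i)) //= !mxE eqxx mul1r.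
rewrite (inj_eq embed_inj) big1 ?addr0 // => k ki.
by rewrite !mxE (negPf ki) mul0r.
Qed.

Lemma embed_mxE (N : 'M_q) i j : (E *m N *m E^T) (phi i) (phi j) = N i j.
Proof.
rewrite mxE (bigD1 j) //= !mxE eqxx mulr1 [X in _ + X]big1 => [|k kj];
  last first.
  by rewrite !mxE (inj_eq embed_inj) eq_sym (negPf kj) mulr0.
rewrite addr0 (bigD1 i) //= mxE eqxx mul1r big1 ?addr0 // => k ki.
by rewrite mxE (inj_eq embed_inj) eq_sym (negPf ki) mul0r.
Qed.

Lemma embed_mx0l (N : 'M_q) i k :
  (forall j, i != phi j) -> (E *m N *m E^T) i k = 0.
Proof.
move=> iphi; rewrite -mulmxA mxE big1 // => j _.
by rewrite mxE (negPf (iphi j)) mul0r.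
Qed.

Lemma embed_mx0r (N : 'M_q) i k :
  (forall j, k != phi j) -> (E *m N *m E^T) i k = 0.
Proof.
move=> kphi; rewrite mxE big1 // => j _.
by rewrite !mxE (negPf (kphi j)) mulr0.
Qed.

Lemma embed_trig (N : 'M_q) : is_trig_mx N -> is_trig_mx (E *m N *m E^T).
Proof.
move=> /is_trig_mxP tN; apply/is_trig_mxP=> i k ik.
have [/existsP[j /eqP ij]|/existsPn /embed_mx0l-> //] :=
  boolP [exists j, i == phi j].
have [/existsP[l /eqP kl]|/existsPn /embed_mx0r-> //] :=
  boolP [exists j, k == phi j].
by rewrite ij kl embed_mxE tN // -phi_mono -ij -kl.
Qed.

End Embed.

End ThreeBlocks.

(** * Overlapping the two smaller diagonal blocks inside the largest one *)

Section Overlap.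
Variables (F : fieldType) (p q r : nat).
Hypotheses (qp : (q <= p)%N) (rp : (r <= p)%N) (pqr : (p <= q + r)%N).

Fact last_ord_subproof (j : 'I_r) : (j + (p - r) < p)%N.
Proof. by rewrite -{2}(subnKC rp) ltn_add2r. Qed.

(** Initial and final segments of the indices of the largest block; they cover it because
    [p <= q + r]. *)
Definition first_ord : 'I_q -> 'I_p := widen_ord qp.
Definition last_ord (j : 'I_r) : 'I_p := Ordinal (last_ord_subproof j).

Lemma first_ord_mono : {mono first_ord : i j / (i < j)%N}.
Proof. by []. Qed.

Lemma last_ord_mono : {mono last_ord : i j / (i < j)%N}.
Proof. by move=> i j /=; rewrite ltn_add2r. Qed.

Let E2 : 'M[F]_(p, q) := embed_mx F first_ord.
Let E3 : 'M[F]_(p, r) := embed_mx F last_ord.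

(** Where the two segments overlap, [N3] has zero diagonal, so each index receives [d i] exactly
    once. *)
Lemma overlap_diag (d : 'I_p -> F) (N2 : 'M[F]_q) (N3 : 'M[F]_r) :
    (forall j, N2 j j = d (first_ord j)) ->
    (forall j, N3 j j = if (last_ord j < q)%N then 0 else d (last_ord j)) ->
  forall i, (E2 *m N2 *m E2^T + E3 *m N3 *m E3^T) i i = d i.
Proof.
move=> dN2 dN3 i; rewrite mxE.
have [iq|qi] := ltnP i q.
  have {1 2}-> : i = first_ord (Ordinal iq) by apply: val_inj.
  rewrite (embed_mxE first_ord_mono) dN2.
  have -> : first_ord (Ordinal iq) = i by apply: val_inj.
  have [/existsP[j /eqP ij]|/existsPn ni] := boolP [exists j, i == last_ord j].
    by rewrite ij (embed_mxE last_ord_mono) dN3 -ij iq addr0.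
  by rewrite (embed_mx0l _ _ ni) addr0.
rewrite embed_mx0l ?add0r => [|j]; last first.
  by apply: contraTneq qi => ->; rewrite -ltnNge /= ltn_ord.
have pri : (p - r <= i)%N by apply: leq_trans qi; rewrite leq_subLR addnC.
have lt_r : (i - (p - r) < r)%N by rewrite ltn_subLR // addnC subnKC.
have ij : i = last_ord (Ordinal lt_r) by apply: val_inj; rewrite /= subnK.
by rewrite {1 2}ij (embed_mxE last_ord_mono) dN3 -ij ltnNge qi.
Qed.

(** [G1 - G2] realizes the diagonal blocks of [b]; [G3 - G4], an upper minus a lower block
    triangular matrix with the same diagonal blocks, then corrects everything else. *)
Lemma diag3_zero_diag (T1 : 'M[F]_p) (T2 : 'M_q) (T3 : 'M_r)
    (b : 'M_(p + (q + r))) :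
    [pchar F] =i pred0 ->
    coprimep (char_poly T1) (char_poly T2) ->
    coprimep (char_poly T1) (char_poly T3) ->
    coprimep (char_poly T2) (char_poly T3) ->
    (forall i, b i i = 0) ->
  let sim := similar_mx (diag3_mx T1 T2 T3) in
  exists G1 G2 G3 G4,
    [/\ sim G1, sim G2, sim G3, sim G4 & b = (G1 - G2) + (G3 - G4)].
Proof.
move=> ch c12 c13 c23 b0 sim.
pose d (i : 'I_p) : F := (i : nat)%:R.
have d_inj : injective d.
  move=> i j; rewrite /d => ij; apply: val_inj => /=.
  wlog le_ij : i j ij / (i <= j)%N.
    by move=> W; case: (leqP i j) => [|/ltnW] /W; [apply|move/(_ (esym ij)) ->].
  apply/eqP; rewrite eqn_leq le_ij -subn_eq0 -((pcharf0P F).1 ch).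
  by rewrite natrB // ij subrr eqxx.
(* The sign is reversed because the shift subtracts [M] from [T1] but adds [N2] and [N3] to [T2] and
   [T3]. *)
have [|M [M' [bM tM tM' dM dM']]] := @zero_diag_split _ _ (- ulsubmx b) d.
  by move=> i; rewrite !mxE b0 oppr0.
have [|N2 [N2' [bN2 tN2 tN2' dN2 dN2']]] :=
    @zero_diag_split _ _ (ulsubmx (drsubmx b)) (d \o first_ord).
  by move=> i; rewrite !mxE b0.
have [|N3 [N3' [bN3 tN3 tN3' dN3 dN3']]] :=
    @zero_diag_split _ _ (drsubmx (drsubmx b))
      (fun j => if (last_ord j < q)%N then 0 else d (last_ord j)).
  by move=> i; rewrite !mxE b0.
have E2K := @embed_mxK F _ _ _ first_ord_mono.
have E3K := @embed_mxK F _ _ _ last_ord_mono.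
have trigK A B : is_trig_mx A -> is_trig_mx B ->
    is_trig_mx (E2 *m A *m E2^T + E3 *m B *m E3^T).
  move=> /(embed_trig first_ord_mono)/is_trig_mxP tA.
  move=> /(embed_trig last_ord_mono)/is_trig_mxP tB.
  by apply/is_trig_mxP=> i j ij; rewrite mxE tA // tB // addr0.
have sK : similar_mx (E2 *m N2 *m E2^T + E3 *m N3 *m E3^T) M.
  apply: similar_trig2 => //; first exact: trigK.
    by move=> i; rewrite (overlap_diag dN2 dN3) dM.
  by move=> i j; rewrite !(overlap_diag dN2 dN3) => /d_inj.
(* The primed parts are upper triangular, hence the passage to transposes. *)
have sK' : similar_mx (E2 *m N2' *m E2^T + E3 *m N3' *m E3^T) M'.
  rewrite -[X in similar_mx X]trmxK -[M']trmxK; apply: similar_tr.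
  apply: similar_trig2 => //.
  - by rewrite linearD /= !trmx_mul !trmxK !mulmxA; apply: trigK.
  - by move=> i; rewrite [LHS]mxE [RHS]mxE (overlap_diag dN2' dN3') dM'.
  - by move=> i j; rewrite ![_^T _ _]mxE !(overlap_diag dN2' dN3') => /d_inj.
have [W [X [Y [Z s1]]]] := similar_diag3_shift c12 c13 c23 E2K E3K sK.
have [W' [X' [Y' [Z' s2]]]] := similar_diag3_shift c12 c13 c23 E2K E3K sK'.
pose b' := drsubmx b.
pose U := block_mx T1 (ursubmx b - (W - W')) 0
            (block_mx T2 (ursubmx b' - (Y - Y')) 0 T3).
pose L := block_mx T1 0 (- (dlsubmx b - (X - X')))
            (block_mx T2 0 (- (dlsubmx b' - (Z - Z'))) T3).
exists (block_mx (T1 - M) W X (block_mx (T2 + N2) Y Z (T3 + N3))),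
  (block_mx (T1 - M') W' X' (block_mx (T2 + N2') Y' Z' (T3 + N3'))), U, L.
split=> //; [exact: similar_ublock3|exact: similar_lblock3|].
rewrite !opp_block_mx !add_block_mx !opprK -[LHS]submxK -[drsubmx b]submxK -/b'.
rewrite bN2 bN3 !subr0 !add0r !subrr !addr0 -[ulsubmx b]opprK bM.
have e (A B C : 'M[F]_p) : A - B - (A - C) = - (B - C).
  by rewrite opprD opprK addrACA subrr add0r opprB addrC.
have e' n (A B C : 'M[F]_n) : A + B - (A + C) = B - C.
  by rewrite opprD addrACA subrr add0r.
have f m n (A B C : 'M[F]_(m, n)) : A - B + (C - (A - B)) = C.
  by rewrite addrC subrK.
by rewrite e !e' !f.
Qed.

End Overlap.

(** * Trace zero matrices *)

Definition disjoint_seq (T : eqType) (s1 s2 : seq T) :=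
  {in s1, forall x, x \notin s2}.

(** Distinct values are collected greedily while they account for at most half of [s]; the value [x]
    that crosses this threshold forms the second group, the rest the third. *)
Lemma perm_three_groups (T : eqType) (s : seq T) :
    (forall x, 2 * count_mem x s <= size s)%N ->
  exists s1 s2 s3, [/\ perm_eq s (s1 ++ (s2 ++ s3)),
    disjoint_seq s1 s2, disjoint_seq s1 s3, disjoint_seq s2 s3 &
    [/\ 2 * size s1 <= size s, 2 * size s2 <= size s &
        2 * size s3 <= size s]%N].
Proof.
move=> half; case: s half => [|y s'] half; first by exists [::], [::], [::].
set s := y :: s' in half *; pose u := undup s.
pose g j := count (mem (take j u)) s.
have g0 : (2 * g 0 <= size s)%N by rewrite /g take0 count_pred0.
have g_max j : (2 * g j <= size s -> j <= size u)%N.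
  move=> h; rewrite leqNgt; apply: contraL h => /ltnW/take_oversize;
    rewrite /g => ->.
  rewrite (eq_in_count (a2 := xpredT)) => [|x xs]; last by rewrite /= mem_undup.
  by rewrite count_predT /=; lia.
have exg : exists j, (2 * g j <= size s)%N by exists 0%N.
have [j gj j_max] := ex_maxnP exg g_max.
have ju : (j < size u)%N.
  rewrite ltnNge; apply: contraL gj => /take_oversize; rewrite /g => ->.
  rewrite (eq_in_count (a2 := xpredT)) => [|x xs]; last by rewrite /= mem_undup.
  by rewrite count_predT /=; lia.
have gj1 : (size s < 2 * g j.+1)%N.
  by rewrite ltnNge; apply/negP=> /j_max; rewrite ltnn.
pose x := nth y u j.
have uj : take j.+1 u = rcons (take j u) x by rewrite (take_nth y).
have xj : x \notin take j u.
  have : uniq (take j.+1 u) by rewrite take_uniq ?undup_uniq.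
  by rewrite uj rcons_uniq => /andP[].
exists (filter (mem (take j u)) s), (filter (pred1 x) s),
       (filter (predC (mem (take j.+1 u))) s); split.
- rewrite -(perm_filterC (mem (take j u)) s) perm_cat2l.
  rewrite -(perm_filterC (pred1 x)) -!filter_predI.
  rewrite (eq_filter (a2 := pred1 x)) => [|z /=]; last first.
    by case: eqVneq => // ->; rewrite xj.
  rewrite (@eq_filter _ (predI (predC _) _) (predC (mem (take j.+1 u)))) // =>
    z /=.
  by rewrite uj mem_rcons in_cons negb_or.
- move=> z; rewrite !mem_filter /= => /andP[zj _]; rewrite negb_and.
  by apply/orP; left; apply: contraNneq xj => <-.
- move=> z; rewrite !mem_filter /= => /andP[zj _].
  by rewrite uj mem_rcons in_cons zj orbT.
- move=> z; rewrite !mem_filter /= => /andP[/eqP-> _].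
  by rewrite uj mem_rcons in_cons eqxx.
split; rewrite size_filter; [exact: gj|exact: half|].
(* The first [j + 1] distinct values fill more than half of [s], leaving less than half. *)
have := count_predC (mem (take j.+1 u)) s; rewrite -/(g j.+1); lia.
Qed.

(** The largest group is put first; that it is at most half of the total is the last inequality. *)
Lemma perm_three_groups_max (T : eqType) (s : seq T) :
    (forall x, 2 * count_mem x s <= size s)%N ->
  exists s1 s2 s3, [/\ perm_eq s (s1 ++ (s2 ++ s3)),
    disjoint_seq s1 s2, disjoint_seq s1 s3, disjoint_seq s2 s3 &
    [/\ size s2 <= size s1, size s3 <= size s1 &
        size s1 <= size s2 + size s3]%N].
Proof.
have disjC (a b : seq T) : disjoint_seq a b -> disjoint_seq b a.
  by move=> ab x xb; apply/negP => /ab; rewrite xb.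
move=> /perm_three_groups[a [b [c [ps ab ac bc [ha hb hc]]]]].
have := perm_size ps; rewrite !size_cat => sz.
have [ba|/ltnW ba] := leqP (size b) (size a);
have [ca|/ltnW ca] := leqP (size c) (size a);
have [cb|/ltnW cb] := leqP (size c) (size b).
all: try by (exists a, b, c; split=> //; split; lia).
all: try by (exists b, a, c; split; [by rewrite perm_sym perm_catCA
  perm_sym|exact: disjC|by []|by []|split; lia]).
all: exists c, a, b; split; [by rewrite (permPl ps) catA perm_catC|exact: disjC|
  exact: disjC|by []|split; lia].
Qed.

(** * Decomposition within a similarity-invariant set *)

Section Decomposition.
Variable F : closedFieldType.

(** Triangularizing in the given order puts each packet on its own diagonal block; disjointness
    makes these blocks coprime, so the blocks below can be cleared. *)
Lemma similar_diag3 p q r (s1 s2 s3 : seq F) (G : 'M[F]_(p + (q + r))) :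
    size s1 = p -> size s2 = q -> size s3 = r ->
    disjoint_seq s1 s2 -> disjoint_seq s1 s3 -> disjoint_seq s2 s3 ->
    char_poly G = \prod_(x <- s1 ++ (s2 ++ s3)) ('X - x%:P) ->
  exists T1 T2 T3, [/\ similar_mx G (diag3_mx T1 T2 T3),
    coprimep (char_poly T1) (char_poly T2),
    coprimep (char_poly T1) (char_poly T3) &
    coprimep (char_poly T2) (char_poly T3)].
Proof.
move=> z1 z2 z3 d12 d13 d23 /similar_trig[L [GL tL dL]].
pose L' := drsubmx L.
have tL' : is_trig_mx L' by apply: drsubmx_trig.
have e1 (i : 'I_p) : ulsubmx L i i \in s1.
  by rewrite !mxE dL nth_cat z1 /= ltn_ord mem_nth ?z1.
have e2 (i : 'I_q) : ulsubmx L' i i \in s2.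
  by rewrite !mxE dL nth_cat z1 /= ltnNge leq_addr /= addKn nth_cat z2 ltn_ord
    mem_nth ?z2.
have e3 (i : 'I_r) : drsubmx L' i i \in s3.
  rewrite !mxE dL nth_cat z1 /= ltnNge leq_addr /= addKn nth_cat z2 ltnNge
    leq_addr /=.
  by rewrite addKn mem_nth ?z3.
have t1 : is_trig_mx (ulsubmx L) by apply: ulsubmx_trig.
have t2 : is_trig_mx (ulsubmx L') by apply: ulsubmx_trig.
have t3 : is_trig_mx (drsubmx L') by apply: drsubmx_trig.
have neq (a b : seq F) x y : disjoint_seq a b -> x \in a -> y \in b -> x != y.
  by move=> ab /ab xb yb; apply: contraNneq xb => ->.
have c12 : coprimep (char_poly (ulsubmx L)) (char_poly (ulsubmx L')).
  by apply: coprimep_char_poly_trig => // i j; apply: neq (e1 i) (e2 j).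
have c13 : coprimep (char_poly (ulsubmx L)) (char_poly (drsubmx L')).
  by apply: coprimep_char_poly_trig => // i j; apply: neq (e1 i) (e3 j).
have c23 : coprimep (char_poly (ulsubmx L')) (char_poly (drsubmx L')).
  by apply: coprimep_char_poly_trig => // i j; apply: neq (e2 i) (e3 j).
exists (ulsubmx L), (ulsubmx L'), (drsubmx L'); split=> //.
apply: similar_trans GL _; apply: similar_sym.
have {2}-> : L = block_mx (ulsubmx L) 0 (dlsubmx L)
                   (block_mx (ulsubmx L') 0 (dlsubmx L') (drsubmx L')).
  by rewrite -(ursubmx_trig _ tL) // -(ursubmx_trig _ tL') // !submxK.
exact: similar_lblock3.
Qed.

Theorem trace0_decomposition N (P : 'M[F]_N -> Prop) G B :
    [pchar F] =i pred0 ->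
    (forall A A', similar_mx A A' -> P A -> P A') ->
    P G -> (forall x, 2 * mup x (char_poly G) <= N)%N -> \tr B = 0 ->
  exists G1 G2 G3 G4,
    [/\ P G1, P G2, P G3, P G4 & B = (G1 - G2) + (G3 - G4)].
Proof.
move=> ch Psim PG mG trB.
have [s sG] := closed_field_poly_normal (char_poly G).
rewrite (monicP (char_poly_monic G)) scale1r in sG.
have sN : size s = N.
  by have := size_char_poly G; rewrite sG size_prod_XsubC => -[].
have [|s1 [s2 [s3 [ps d12 d13 d23 [h2 h3 h1]]]]] := @perm_three_groups_max _ s.
  by move=> x; rewrite -mu_prod_XsubC -sG sN.
rewrite (perm_big _ ps) /= in sG.
have eN : N = (size s1 + (size s2 + size s3))%N.
  by rewrite -sN (perm_size ps) !size_cat.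
(* Replacing [N] by the sum of the packet sizes gives [G] and [B] the required block shape. *)
clear sN; subst N.
have [T1 [T2 [T3 [GT c12 c13 c23]]]] :=
  similar_diag3 erefl erefl erefl d12 d13 d23 sG.
have [b Bb b0] := similar_zero_diag ch trB.
have [G1 [G2 [G3 [G4 [s1' s2' s3' s4' bE]]]]] :=
  diag3_zero_diag h2 h3 h1 ch c12 c13 c23 b0.
have [S uS SB] := Bb.
have PT A : similar_mx (diag3_mx T1 T2 T3) A -> P (invmx S *m A *m S).
  move=> TA; apply: Psim PG; apply: similar_trans GT _;
    apply: similar_trans TA _.
  by rewrite -[X in _ *m X]invmxK; apply: similar_conj; rewrite unitmx_inv.
exists (invmx S *m G1 *m S), (invmx S *m G2 *m S),
  (invmx S *m G3 *m S), (invmx S *m G4 *m S); split; try exact: PT.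
by rewrite -[LHS](mulKmx uS) SB bE mulmxA mulmxDr mulmxDl !mulmxBr !mulmxBl.
Qed.
End Decomposition.

(** * Eigenvalue multiplicities *)

Section Derivatives.
Variable F : fieldType.
Hypothesis char0 : [pchar F] =i pred0.

Lemma natr_neq0 n : n.+1%:R != 0 :> F.
Proof. by rewrite ((pcharf0P F).1 char0). Qed.

(** Each derivative of [q * ('X - x%:P) ^+ m.+1] lowers the exponent by one and multiplies the value
    of the cofactor at [x] by [m.+1], nonzero in characteristic zero. *)
Lemma derivn_mup (p : {poly F}) x :
  p != 0 -> ~~ root (p^`(mup x p)) x.
Proof.
move=> p0; have [m [q /implyP/(_ p0) qx pE]] := multiplicity_XsubC p x.
have -> : mup x p = m.
  by rewrite pE mupMr // mup_XsubCX eqxx.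
rewrite {}pE {p0}; elim: m q qx => [|m IHm] q qx; first by rewrite mulr1.
rewrite derivSn derivM deriv_exp derivB derivX derivC subr0 mul1r /=.
set Q := (X in X^`(m));
suff -> : Q = (q^`() * ('X - x%:P) + q *+ m.+1) * ('X - x%:P) ^+ m.
  apply: IHm; rewrite rootE hornerD hornerM hornerXsubC subrr mulr0 add0r.
  by rewrite hornerMn -mulr_natr mulf_eq0 negb_or qx natr_neq0.
by rewrite /Q mulrDl exprS mulrA mulrnAr mulrnAl.
Qed.

Lemma root_derivn (p : {poly F}) x h i :
  ('X - x%:P) ^+ h.+1 %| p -> (i <= h)%N -> root (p^`(i)) x.
Proof.
elim: i h p => [|i IHi] h p.
  by move=> xp _; rewrite -dvdp_XsubCl; apply: dvdp_trans xp;
    rewrite exprS dvdp_mulr.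
case: h => // h xp ih; rewrite derivSn; apply: IHi ih.
have /dvdpP[q ->] := xp.
rewrite derivM deriv_exp /= dvdp_add //.
  by rewrite dvdp_mull // dvdp_exp2l.
by rewrite dvdp_mull // -mulr_natr dvdp_mulr // dvdp_mull ?dvdpp.
Qed.

Lemma horner_mx_coprime n (A : 'M[F]_n.+1) p :
  coprimep (char_poly A) p -> horner_mx A p \in unitmx.
Proof.
move=> /Bezout_eq1_coprimepP[[u v] /= /(congr1 (horner_mx A))].
rewrite rmorphD !rmorphM /= Cayley_Hamilton mulr0 add0r rmorph1.
by move=> /mulmx1_unit[].
Qed.

Lemma horner_mx_eigen n (A : 'M[F]_n.+1) (v : 'rV_n.+1) x p :
  v *m A = x *: v -> v *m horner_mx A p = p.[x] *: v.
Proof.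
move=> vA; elim/poly_ind: p => [|p c IHp];
  first by rewrite rmorph0 mulmx0 horner0 scale0r.
rewrite rmorphD rmorphM /= horner_mx_X horner_mx_C mulmxDr -mulmxE mulmxA IHp.
by rewrite -scalemxAl vA scalerA mul_mx_scalar hornerMXaddC scalerDl.
Qed.

Lemma horner_mx_unit_root n (A : 'M[F]_n.+1) x p :
  horner_mx A p \in unitmx -> root (char_poly A) x -> ~~ root p x.
Proof.
move=> up; rewrite -eigenvalue_root_char => /eigenvalueP[v vA v0].
apply: contra v0 => /rootP px; have := horner_mx_eigen p vA.
by rewrite px scale0r => /(canRL (mulmxK up)) ->; rewrite mul0mx.
Qed.

End Derivatives.

(** A root of multiplicity above [h] kills all derivatives of order at most [h], hence the
    combination [r t]. For a suitable [c], [r 0] and [p 0] have no common root, and this persists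
    for some [t != 0]. *)
Lemma mup_horner_open (F : closedFieldType) n (G : 'M[{poly F}]_n.+1) h :
    [pchar F] =i pred0 ->
    (forall x, mup x (char_poly (map_mx (horner_eval 0) G)) <= h)%N ->
  exists2 t, t != 0 &
    forall x, (mup x (char_poly (map_mx (horner_eval t) G)) <= h)%N.
Proof.
move=> char0 G0; pose p t := char_poly (map_mx (horner_eval t) G).
have p_neq0 t : p t != 0 by apply/monic_neq0/char_poly_monic.
have [s sp] := closed_field_poly_normal (p 0).
(* A polynomial in the future [c], nonzero because the derivative of order [mup x (p 0) <= h] does
   not vanish at [x]. *)
pose Q x := \poly_(i < h.+1) (p 0)^`(i).[x].
have [c cQ] : exists c, ~~ root (\prod_(x <- s) Q x) c.
  apply/closed_nonrootP; rewrite prodf_seq_neq0; apply/allP => x _ /=.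
  apply/eqP=> /polyP/(_ (mup x (p 0))); rewrite coef_poly ltnS G0 coef0.
  by apply/eqP; rewrite -rootE; exact: derivn_mup.
pose r t := \sum_(i < h.+1) c ^+ i *: (p t)^`(i).
pose R := \sum_(i < h.+1) (c ^+ i)%:P *: (char_poly G)^`(i).
(* At [t] this is the resultant of [p t] and [r t], in a form visibly polynomial in [t]. *)
pose delta := \det (horner_mx G R).
have deltaE t : delta.[t] = \det (horner_mx (map_mx (horner_eval t) G) (r t)).
  rewrite -[LHS]/(horner_eval t delta) -det_map_mx map_horner_mx;
    congr (\det (horner_mx _ _)).
  rewrite /R rmorph_sum; apply: eq_bigr => i _ /=.
  by rewrite map_polyZ -derivn_map map_char_poly /= /horner_eval hornerC.
have delta0 : delta.[0] != 0.
  rewrite deltaE -unitfE -unitmxE; apply: horner_mx_coprime.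
  rewrite -/(p 0) sp coprimepZl ?lead_coef_eq0 //.
  move: cQ; rewrite rootE horner_prod; elim: (s) => [|x l IHl];
    first by rewrite !big_nil coprime1p.
  rewrite !big_cons mulf_eq0 negb_or coprimepMl => /andP[xQ /IHl ->];
    rewrite andbT.
  rewrite coprimep_sym coprimep_XsubC rootE.
  move: xQ; rewrite horner_poly /r horner_sum; congr (_ != 0).
  by apply: eq_bigr => i _; rewrite hornerZ mulrC.
(* The factor ['X] excludes [t = 0]. *)
have [t] : exists t, ~~ root ('X * delta) t.
  apply/closed_nonrootP; rewrite mulf_neq0 ?polyX_eq0 //.
  by apply: contraNneq delta0 => ->; rewrite horner0.
rewrite rootM rootX negb_or => /andP[t0 dt]; exists t => // x.
rewrite leqNgt; apply/negP; rewrite mup_geq => [xp|]; last exact: p_neq0.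
have := xp => /root_derivn xr.
move: dt; rewrite rootE deltaE -unitfE -unitmxE.
move=> /horner_mx_unit_root/(_ (xr 0%N isT))/negP; apply.
by rewrite rootE horner_sum big1 // => i _;
  rewrite hornerZ (rootP (xr i _)) ?mulr0 // -ltnS.
Qed.

Section ScaleInvariant.
Variable F : closedFieldType.

(* If [A] is similar to [zeta *: A], the roots [x] and [zeta * x] of its
   characteristic polynomial have the same multiplicity. *)
Lemma mup_similar_scale n (A : 'M[F]_n) zeta x :
    A \in unitmx -> zeta != 1 -> zeta != 0 -> similar_mx A (zeta *: A) ->
  (2 * mup x (char_poly A) <= n)%N.
Proof.
move=> uA z1 z0 sA.
have [s sP] := closed_field_poly_normal (char_poly A).
rewrite (monicP (char_poly_monic A)) scale1r in sP.
have sn : size s = n.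
  by have := size_char_poly A; rewrite sP size_prod_XsubC => -[].
have [L [[S uS SA] tL dL]] := similar_trig sP.
have szP : char_poly A = \prod_(y <- map ( *%R zeta) s) ('X - y%:P).
  rewrite (similar_char_poly sA).
  have /similar_char_poly -> : similar_mx (zeta *: A) (zeta *: L).
    by exists S; rewrite // -scalemxAr SA scalemxAl.
  rewrite char_poly_trig; last first.
    apply/is_trig_mxP=> i j ij.
    by have /is_trig_mxP tL' := tL; rewrite mxE tL' // mulr0.
  rewrite big_map (big_nth 0) big_mkord sn; apply: eq_bigr => i _.
  by rewrite mxE dL.
have mx : count_mem (zeta * x) s = count_mem x s.
  rewrite -[LHS]mu_prod_XsubC -sP szP mu_prod_XsubC count_map.
  by apply: eq_count => y /=; rewrite (inj_eq (mulfI z0)).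
have x0 : x = 0 -> count_mem x s = 0%N.
  move=> ->; apply/count_memPn; rewrite -root_prod_XsubC -sP
    -eigenvalue_root_char.
  apply/eigenvalueP=> -[v vA /negP[]].
  by rewrite -[v](mulmxK uA) vA scale0r mul0mx.
rewrite sP mu_prod_XsubC; have [/x0 -> //|{}x0] := eqVneq x 0.
(* The occurrences of [x] and of [zeta * x] in [s] are disjoint and equally many, so together they
   number at most [n]. *)
have zx : zeta * x != x by rewrite -{2}[x]mul1r (inj_eq (mulIf x0)).
rewrite mul2n -addnn -{2}mx -sn -(count_predT s) -count_predUI.
rewrite [X in (_ + X)%N](eq_count (a2 := pred0)) => [|y /=]; last first.
  by apply/negP=> /andP[/eqP -> /eqP e]; rewrite -e eqxx in zx.
by rewrite count_pred0 addn0; apply: sub_count.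
Qed.

(** In characteristic zero ['X^n - 1] is separable, and [n] distinct roots of unity of order
    dividing [n] include a primitive one. *)
Lemma prim_root_exists n :
  [pchar F] =i pred0 -> (0 < n)%N -> exists z : F, n.-primitive_root z.
Proof.
move=> char0 n0; have [s sP] := closed_field_poly_normal ('X^n - 1 : {poly F}).
rewrite lead_coefXnsubC // scale1r in sP.
have : has n.-primitive_root s.
  apply: cyclic.has_prim_root => //.
  - by apply/allP=> z zs; rewrite /= /root_of_unity sP root_prod_XsubC.
  - rewrite -separable_prod_XsubC -sP separable_Xn_sub_1 //.
    by case: (n) n0 => // m _; apply: natr_neq0.
  - by rewrite -ltnS -(size_prod_XsubC s id) -sP size_XnsubC.
by case/hasP=> z _ zP; exists z.
Qed.
End ScaleInvariant.

(** * Clock and shift matrices *)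

Section Weyl.
Variables (F : fieldType) (n : nat) (w : F).
Hypotheses (char0 : [pchar F] =i pred0) (wP : n.+2.-primitive_root w).
Local Notation A := 'M[F]_n.+2.

Lemma root_expr_neq0 k : w ^+ k != 0.
Proof.
apply/expf_neq0/eqP=> w0; have /eqP := prim_expr_order wP.
by rewrite w0 expr0n eq_sym oner_eq0.
Qed.

Definition clock_mx : A := diag_mx (\row_(i < n.+2) w ^+ i).
(** Addition in ['I_n.+2] is modulo [n.+2], so this is the cyclic shift. *)
Definition shift_mx : A := \matrix_(i, j) (j == i + 1)%:R.
Definition weyl_mx j k : A := clock_mx ^+ j * shift_mx ^+ k.

Lemma clockX k : clock_mx ^+ k = diag_mx (\row_(i < n.+2) w ^+ (i * k)).
Proof.
elim: k => [|k IHk].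
  by apply/matrixP=> i j; rewrite !mxE muln0.
rewrite exprS IHk -mulmxE mulmx_diag; congr diag_mx; apply/rowP=> i.
by rewrite !mxE mulnS exprD.
Qed.

Lemma shiftX k : shift_mx ^+ k = \matrix_(i, j) (j == i + k%:R)%:R.
Proof.
elim: k => [|k IHk].
  by apply/matrixP=> i j; rewrite !mxE addr0 eq_sym.
rewrite exprSr IHk -mulmxE; apply/matrixP=> i j; rewrite !mxE.
rewrite (bigD1 (i + k%:R)) //= !mxE eqxx mul1r big1 ?addr0 => [|l li].
  by rewrite -natr1 addrA.
by rewrite mxE (negPf li) mul0r.
Qed.

Lemma clock_order : clock_mx ^+ n.+2 = 1.
Proof.
rewrite clockX; apply/matrixP=> i j.
by rewrite !mxE mulnC exprM (prim_expr_order wP) expr1n.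
Qed.

Lemma shift_order : shift_mx ^+ n.+2 = 1.
Proof.
rewrite shiftX; apply/matrixP=> i j; rewrite !mxE.
have -> : n.+2%:R = 0 :> 'I_n.+2 by rewrite Zp_nat; apply: val_inj;
  rewrite /= modnn.
by rewrite addr0 eq_sym.
Qed.

Lemma shift_clock : shift_mx * clock_mx = w *: (clock_mx * shift_mx).
Proof.
rewrite -!mulmxE mul_mx_diag mul_diag_mx; apply/matrixP=> i j; rewrite !mxE.
have [->|_] := eqVneq j (i + 1); last by rewrite mul0r !mulr0.
rewrite mul1r mulr1 /= modnDmr (prim_expr_mod wP) addn1 exprS //.
Qed.

Lemma shiftX_clockX j k :
  shift_mx ^+ k * clock_mx ^+ j =
    w ^+ (j * k) *: (clock_mx ^+ j * shift_mx ^+ k).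
Proof.
have sXc : shift_mx ^+ k * clock_mx = w ^+ k *: (clock_mx * shift_mx ^+ k).
  elim: k => [|k IHk]; first by rewrite !expr0 scale1r mul1r mulr1.
  rewrite [shift_mx ^+ _]exprS -mulrA IHk -scalerAr [shift_mx * (_ * _)]mulrA.
  by rewrite shift_clock -scalerAl scalerA -exprSr -mulrA -exprS.
elim: j => [|j IHj]; first by rewrite !expr0 scale1r mulr1 mul1r.
rewrite [in LHS]exprSr mulrA IHj -scalerAl -mulrA sXc -scalerAr scalerA.
by rewrite [in LHS]mulrA -exprD mulSn addnC -exprSr.
Qed.

Lemma weylM j k j' k' :
  weyl_mx j k * weyl_mx j' k' = w ^+ (j' * k) *: weyl_mx (j + j') (k + k').
Proof.
rewrite /weyl_mx mulrA -[_ * _ * _ ^+ j']mulrA shiftX_clockX -scalerAr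
  -scalerAl.
by rewrite !exprD !mulrA.
Qed.

Lemma clock_unit : clock_mx \is a GRing.unit.
Proof. by rewrite -(unitrX_pos _ (ltn0Sn n.+1)) clock_order unitr1. Qed.

Lemma shift_unit : shift_mx \is a GRing.unit.
Proof. by rewrite -(unitrX_pos _ (ltn0Sn n.+1)) shift_order unitr1. Qed.

Lemma weyl_unit j k : weyl_mx j k \is a GRing.unit.
Proof. by rewrite /weyl_mx unitrMl unitrX ?clock_unit ?shift_unit. Qed.

(** Discrete Fourier inversion: averaging the powers of the clock matrix against [w ^- (a * j)]
    projects onto coordinate [a], and the shift then moves [a] to [b]. *)
Lemma delta_weyl a b : delta_mx a b =
  n.+2%:R^-1 *: \sum_(j < n.+2) (w ^- (a * j)) *: weyl_mx j (b - a)%R :> A.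
Proof.
have n0 : n.+2%:R != 0 :> F by apply: natr_neq0 char0 _.
apply: (canRL (scalerK n0)); apply/matrixP=> i j.
rewrite summxE 2!mxE.
under eq_bigr => k _.
  rewrite mxE /weyl_mx clockX shiftX -mulmxE mul_diag_mx !mxE mulrA.
  over.
rewrite -mulr_suml natr_Zp.
have [->|ij] := eqVneq j (i + (b - a)); last first.
  rewrite mulr0; case: (eqVneq i a) ij => [->|_] ij; last by rewrite mulr0.
  have /negPf -> : j != b by apply: contraNneq ij => ->; rewrite addrC subrK.
  by rewrite mulr0.
rewrite mulr1; have [->|ia] := eqVneq i a.
  rewrite addrC subrK eqxx mulr1 (eq_bigr (fun=> 1)) ?sumr_const ?card_ord //
    => k _.
  by rewrite mulVf ?root_expr_neq0.
(* A geometric sum of ratio [z != 1] with [z ^+ n.+2 = 1] vanishes. *)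
rewrite mulr0; symmetry; set z := w ^+ i / w ^+ a.
rewrite (eq_bigr (fun k : 'I_n.+2 => z ^+ k)) => [|k _]; last first.
  by rewrite /z expr_div_n -!exprM mulrC.
have z1 : z - 1 != 0.
  rewrite subr_eq0; apply: contraNneq ia.
  move=> /(canRL (divfK (root_expr_neq0 a)))/eqP.
  by rewrite mul1r (eq_prim_root_expr wP) !modn_small.
apply: (mulfI z1); rewrite mulr0 -subrX1 expr_div_n -!exprM
  ![(_ * n.+2)%N]mulnC.
by rewrite !exprM (prim_expr_order wP) !expr1n divr1 subrr.
Qed.

(** Conjugation by the shift or the clock matrix yields the factors [w ^+ j] and, read backwards,
    [w ^+ k]; if both are 1, the matrix is the identity. *)
Lemma weyl_similar_scale j k :
  is_scalar_mx (weyl_mx j k) \/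
  exists zeta, [/\ zeta != 1, zeta != 0
    & similar_mx (weyl_mx j k) (zeta *: weyl_mx j k)].
Proof.
have [wj|wj] := eqVneq (w ^+ j) 1; last first.
  right; exists (w ^+ j); split; rewrite ?root_expr_neq0 //; exists shift_mx;
    first exact: shift_unit.
  have -> : shift_mx = weyl_mx 0 1 by rewrite /weyl_mx expr0 mul1r expr1.
  rewrite !mulmxE -scalerAl !weylM muln1 mul0n expr0 scale1r.
  by rewrite add0n addn0 add1n addn1.
have [wk|wk] := eqVneq (w ^+ k) 1; last first.
  right; exists (w ^+ k); split; rewrite ?root_expr_neq0 //; apply: similar_sym.
  exists clock_mx; first exact: clock_unit.
  have -> : clock_mx = weyl_mx 1 0 by rewrite /weyl_mx expr0 mulr1 expr1.
  rewrite !mulmxE -scalerAr !weylM muln0 mul1n expr0 scale1r.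
  by rewrite add0n addn0 add1n addn1.
left; apply/is_scalar_mxP; exists 1.
have : (n.+2 %| j)%N by rewrite (prim_order_dvd wP) wj.
have : (n.+2 %| k)%N by rewrite (prim_order_dvd wP) wk.
move=> /dvdnP[k' ->] /dvdnP[j' ->].
by rewrite /weyl_mx mulnC exprM clock_order mulnC exprM shift_order !expr1n
  mulr1.
Qed.

End Weyl.

(** * Polynomials graded by the clock and shift exponents *)

Section WeylPoly.
Variables (F : fieldType) (n : nat) (w : F).
Hypotheses (char0 : [pchar F] =i pred0) (wP : n.+2.-primitive_root w).
Local Notation A := 'M[F]_n.+2.
Local Notation weyl_mx := (weyl_mx n w).

(* The exponent [j + N * k] of the variable encodes the bidegree [(j, k)] of
   [weyl_mx j k]; the encoding is faithful as long as [j < N]. *)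
Definition weyl_coef N J (e : nat) (M : A) :=
  (exists c, M = c *: weyl_mx (e %% N) (e %/ N)) /\ ((J < e %% N)%N -> M = 0).

Definition weyl_poly N J (g : {poly A}) := forall e, weyl_coef N J e g`_e.

Lemma weyl_coef0 N J e : weyl_coef N J e 0.
Proof. by split=> //; exists 0; rewrite scale0r. Qed.

Lemma weyl_coefD N J e M M' :
  weyl_coef N J e M -> weyl_coef N J e M' -> weyl_coef N J e (M + M').
Proof.
move=> [[c ->] z] [[c' ->] z']; split=> [|Je]; first by exists (c + c');
  rewrite scalerDl.
by rewrite z // z' ?addr0.
Qed.

Lemma weyl_polyW N J J' g : (J <= J')%N -> weyl_poly N J g -> weyl_poly N J' g.
Proof.
move=> JJ' hg e; case: (hg e) => cg zg; split=> // J'e; apply: zg.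
exact: leq_ltn_trans J'e.
Qed.

Lemma weyl_poly0 N J : weyl_poly N J 0.
Proof. by move=> e; rewrite coef0; apply: weyl_coef0. Qed.

Lemma weyl_polyD N J g h : weyl_poly N J g -> weyl_poly N J h ->
  weyl_poly N J (g + h).
Proof. by move=> hg hh e; rewrite coefD; apply: weyl_coefD. Qed.

Lemma weyl_polyZ N J c g : weyl_poly N J g -> weyl_poly N J (c%:M *: g).
Proof.
move=> hg e; rewrite coefZ -mulmxE mul_scalar_mx.
case: (hg e) => -[d ->] zg; split; first by exists (c * d); rewrite scalerA.
by move=> /zg ->; rewrite scaler0.
Qed.

Lemma weyl_poly_monom N j k : (j < N)%N ->
  weyl_poly N j ((weyl_mx j k)%:P * 'X^(j + N * k)).
Proof.
move=> jN e; rewrite coefCM coefXn; case: eqP => [->|_];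
  last by rewrite mulr0; apply: weyl_coef0.
rewrite mulr1 /weyl_coef addnC mulnC modnMDl modn_small // divnMDl; last by lia.
by rewrite divn_small // addn0; split; [exists 1; rewrite scale1r|rewrite ltnn].
Qed.

Lemma weyl_poly1 N J : (0 < N)%N -> weyl_poly N J 1.
Proof.
move=> N0; apply: (@weyl_polyW N 0) => //.
by have := @weyl_poly_monom N 0 0 N0; rewrite muln0 mulr1 /weyl_mx !expr0 mulr1.
Qed.

(** As [J + J' < N], adding exponents causes no carry in base [N], so bidegrees add just as in
    [weylM]. *)
Lemma weyl_polyM N J J' g h : (J + J' < N)%N ->
  weyl_poly N J g -> weyl_poly N J' h -> weyl_poly N (J + J') (g * h).
Proof.
move=> JJ hg hh e; rewrite coefM; apply: (big_ind (weyl_coef N (J + J') e)).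
- exact: weyl_coef0.
- exact: weyl_coefD.
move=> [i /= ie] _.
case: (hg i) (hh (e - i)%N) => -[c ->] zg [[d ->] zh].
have [/zg ->|Ji] := ltnP J (i %% N); first by rewrite mul0r; apply: weyl_coef0.
have [/zh ->|Jj] := ltnP J' ((e - i) %% N); first by rewrite mulr0;
  apply: weyl_coef0.
have eE : e = ((i %/ N + (e - i) %/ N) * N + (i %% N + (e - i) %% N))%N.
  have := divn_eq i N; have := divn_eq (e - i) N; lia.
have N0 : (0 < N)%N by lia.
have sN : (i %% N + (e - i) %% N < N)%N by lia.
have em : (e %% N = i %% N + (e - i) %% N)%N by rewrite {1}eE modnMDl
  modn_small.
have ed : (e %/ N = i %/ N + (e - i) %/ N)%N.
  by rewrite {1}eE divnMDl // (divn_small sN) addn0.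
split; last by rewrite em; lia.
rewrite -scalerAl -scalerAr weylM // !scalerA em ed.
by eexists; reflexivity.
Qed.

Lemma weyl_poly_sum N J (I : Type) (r : seq I) (P : pred I)
    (g : I -> {poly A}) :
    (forall i, P i -> weyl_poly N J (g i)) ->
  weyl_poly N J (\sum_(i <- r | P i) g i).
Proof.
move=> hg; apply: (big_ind (weyl_poly N J)) => //; first exact: weyl_poly0.
exact: weyl_polyD.
Qed.

Lemma weyl_poly_lift N (M : A) : (n.+2 <= N)%N ->
  exists2 g, weyl_poly N n.+2 g & g.[1] = M.
Proof.
move=> nN; rewrite [M]matrix_sum_delta.
pose g (a b : 'I_n.+2) := \sum_(j < n.+2) (n.+2%:R^-1 * w ^- (a * j))%:M *:
  ((weyl_mx j (b - a)%R)%:P * 'X^(j + N * (b - a)%R)) : {poly A}.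
exists (\sum_a \sum_b (M a b)%:M *: g a b).
  apply: weyl_poly_sum => a _; apply: weyl_poly_sum => b _; apply: weyl_polyZ.
  apply: weyl_poly_sum => j _; apply: weyl_polyZ; apply: (@weyl_polyW _ j).
    exact/ltnW.
  by apply: weyl_poly_monom; apply: leq_trans nN.
rewrite horner_sum; apply: eq_bigr => a _; rewrite horner_sum;
  apply: eq_bigr => b _.
rewrite hornerZ -mulmxE mul_scalar_mx; congr (_ *: _).
rewrite (delta_weyl char0 wP) scaler_sumr horner_sum; apply: eq_bigr => j _.
by rewrite hornerZ -mulmxE mul_scalar_mx hornerCM hornerXn expr1n mulr1 scalerA.
Qed.

Lemma weyl_poly_prod N (l : seq nat) (g : nat -> {poly A}) :
  (n.+2 * size l < N)%N -> (forall i, weyl_poly N n.+2 (g i)) ->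
  weyl_poly N (n.+2 * size l) (\prod_(i <- l) g i).
Proof.
move=> + hg; elim: l => [|i l IHl] /= lN.
  by rewrite big_nil; apply: weyl_poly1; lia.
rewrite big_cons mulnS; apply: weyl_polyM => //; first by rewrite -mulnS.
by apply: IHl; lia.
Qed.

End WeylPoly.

(** * Values of noncommutative polynomials *)

Section Values.
Variables (F : closedFieldType) (n : nat) (f : {ncpoly F}).
Hypothesis char0 : [pchar F] =i pred0.
Local Notation A := 'M[F]_n.+2.

Lemma nceval_conj (S : A) a : S \is a GRing.unit ->
  nceval A f (fun i => S * a i * S^-1) = S * nceval A f a * S^-1.
Proof.
move=> uS; rewrite /nceval !mmapE mulr_sumr mulr_suml; apply: eq_bigr => m _.
rewrite /= !mulr_algl -scalerAr -scalerAl; congr (_ *: _).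
rewrite /word_eval; elim: (m : seq nat) => [|i l IHl].
  by rewrite !big_nil mulr1 mulrV.
by rewrite !big_cons IHl !mulrA mulrVK.
Qed.

Lemma nceval_similar a M : similar_mx (nceval A f a) M ->
  exists a', nceval A f a' = M.
Proof.
case=> S uS SM; exists (fun i => S * a i * S^-1).
by rewrite nceval_conj // -mulmxE SM mulmxE mulrK.
Qed.

Lemma nceval_weyl_poly w a : n.+2.-primitive_root w ->
  exists N J (P : {poly A}), [/\ weyl_poly w N J P, P.[1] = nceval A f a &
    forall t, exists a', P.[t%:M] = nceval A f a'].
Proof.
move=> wP; pose L := \max_(m <- msupp f) size (m : seq nat).
(* Large enough to avoid carries in every word of [f]; [L.+1] rather than [L] ensures [n.+2 <= N]
   even for a constant [f]. *)
pose N := (n.+2 * L.+1).+1.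
have nN : (n.+2 <= N)%N by rewrite /N; lia.
have /choice[g hg] : forall i, exists g, weyl_poly w N n.+2 g /\ g.[1] = a i.
  by move=> i; have [g] := weyl_poly_lift char0 wP (a i) nN; exists g.
pose P := \sum_(m <- msupp f) (f@_m)%:M *: \prod_(i <- (m : seq nat)) g i.
have PE t : P.[t%:M] = nceval A f (fun i => (g i).[t%:M]).
  rewrite horner_sum /nceval mmapE; apply: eq_bigr => m _.
  rewrite hornerZ /= mulr_algl -mulmxE mul_scalar_mx; congr (_ *: _).
  rewrite /word_eval; elim: (m : seq nat) => [|i l IHl].
    by rewrite !big_nil hornerC.
  (* Evaluation is multiplicative here because [t%:M] is central. *)
  rewrite !big_cons hornerM_comm ?IHl //.
  by rewrite /comm_poly -!mulmxE scalar_mxC.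
exists N, (n.+2 * L)%N, P; split.
- rewrite /P big_seq; apply: weyl_poly_sum => m mf; apply: weyl_polyZ.
  have mL : (size (m : seq nat) <= L)%N by apply: leq_bigmax_seq.
  apply: (@weyl_polyW _ _ _ _ (n.+2 * size (m : seq nat))%N);
    first by rewrite leq_mul2l mL.
  apply: weyl_poly_prod => // [|i]; last by have [] := hg i.
  by rewrite /N; nia.
- rewrite -[1]/(1%:M) PE; congr nceval; apply/funext => i.
  by have [] := hg i.
by move=> t; exists (fun i => (g i).[t%:M]).
Qed.

(* The lowest non-scalar coefficient of [P] is a multiple of [weyl_mx j k],
   which dominates the other non-scalar ones near [0]. *)
Lemma nceval_small_multiplicity a : ~~ is_scalar_mx (nceval A f a) ->
  exists s t (G : A), [/\ t != 0,
    forall x, (2 * mup x (char_poly G) <= n.+2)%N &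
    exists a', nceval A f a' = s%:M + t *: G].
Proof.
move=> fa; have [w wP] := @prim_root_exists F n.+2 char0 isT.
have [N [J [P [hP P1 Pf]]]] := nceval_weyl_poly a wP.
have scalD (M M' : A) : is_scalar_mx M -> is_scalar_mx M' ->
    is_scalar_mx (M + M').
  move=> /is_scalar_mxP[c ->] /is_scalar_mxP[c' ->]; rewrite -raddfD.
  exact: scalar_mx_is_scalar.
have scalM (M M' : A) : is_scalar_mx M -> is_scalar_mx M' ->
    is_scalar_mx (M * M').
  move=> /is_scalar_mxP[c ->] /is_scalar_mxP[c' ->];
    rewrite -mulmxE -scalar_mxM.
  exact: scalar_mx_is_scalar.
have scal_horner (Q : {poly A}) t : (forall e, is_scalar_mx Q`_e) ->
  is_scalar_mx Q.[t%:M].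
  move=> hQ; rewrite horner_coef; apply: (big_ind (@is_scalar_mx _ _)) => //.
  - by rewrite -(raddf0 (@scalar_mx F n.+2)) scalar_mx_is_scalar.
  - move=> e _; apply: (scalM) => //; elim: (e : nat) => [|k IHk].
      exact: scalar_mx_is_scalar.
    by rewrite exprS; apply: (scalM); rewrite ?scalar_mx_is_scalar.
have : exists e, ~~ is_scalar_mx P`_e.
  apply: contrapT => nP; move: fa; rewrite -P1 -[1]/(1%:M) scal_horner // => e.
  by apply: contrapT => /negP he; apply: nP; exists e.
move=> /ex_minnP[e0 he0 e0_min].
(* Below [e0] all coefficients are scalar, so [P] at [t] is a scalar plus [t ^+ e0] times [D] at
   [t], and [D] at 0 is the lowest non-scalar coefficient. *)
pose D := drop_poly e0 P.
have /choice[s sP] : forall t, exists c, (take_poly e0 P).[t%:M] = c%:M.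
  move=> t; apply/is_scalar_mxP/scal_horner => e.
  rewrite coef_take_poly; case: ltnP => [ee0|_].
    by apply: contraTT ee0 => /e0_min; rewrite leqNgt.
  by rewrite -(raddf0 (@scalar_mx F n.+2)) scalar_mx_is_scalar.
have PE t : P.[t%:M] = (s t)%:M + t ^+ e0 *: D.[t%:M].
  rewrite -[P in LHS](poly_take_drop e0) hornerD sP hornerM_comm; last first.
    by rewrite /comm_poly hornerXn -exprSr exprS.
  rewrite hornerXn; congr (_ + _).
  have -> : (t%:M : A) ^+ e0 = (t ^+ e0)%:M by rewrite rmorphXn.
  by rewrite -mulmxE mul_mx_scalar.
(* [D] reread as a matrix of polynomials, as required by [mup_horner_open]. *)
pose G : 'M[{poly F}]_n.+2 := \matrix_(i, j) \poly_(e < size D) (D`_e i j).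
have GE t : map_mx (horner_eval t) G = D.[t%:M].
  apply/matrixP=> i j; rewrite !mxE /horner_eval horner_poly horner_coef summxE.
  apply: eq_bigr => e _;
  have -> : (t%:M : A) ^+ e = (t ^+ e)%:M by rewrite rmorphXn.
  by rewrite -mulmxE mul_mx_scalar mxE mulrC.
have D0 : D.[0%:M] = P`_e0.
  by rewrite raddf0 horner_coef0 coef_drop_poly.
have [|t t0 mG] := @mup_horner_open F n.+1 G (n.+2)./2 char0.
  move=> x; rewrite GE D0.
  have [[c cE] _] := hP e0; rewrite cE in he0 *.
  have c0 : c != 0.
    by apply: contraNneq he0 => ->; rewrite scale0r
      -(raddf0 (@scalar_mx F n.+2)) scalar_mx_is_scalar.
  have [/is_scalar_mxP[d dE]|[z [z1 z0 [S uS SW]]]] :=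
      weyl_similar_scale wP (e0 %% N) (e0 %/ N).
    by move: he0; rewrite dE scale_scalar_mx scalar_mx_is_scalar.
  rewrite geq_half_double -mul2n; apply: (mup_similar_scale _ _ z1 z0).
      by rewrite unitmxZ ?unitfE //; apply: weyl_unit.
    exists S => //; rewrite -scalemxAr SW scalerA mulrC -scalerA.
    by rewrite -!scalemxAl.
exists (s t), (t ^+ e0), D.[t%:M]; split; first by rewrite expf_neq0.
  by move=> x; have := mG x; rewrite GE geq_half_double -mul2n.
by have [a' Pa] := Pf t; exists a'; rewrite -Pa PE.
Qed.

End Values.

Lemma noncentral_value (F : closedFieldType) n (f : {ncpoly F}) :
    ~ nc_identity 'M[F]_n.+2 f -> ~ nc_central 'M[F]_n.+2 f ->
  exists a, ~~ is_scalar_mx (nceval 'M[F]_n.+2 f a).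
Proof.
move=> nid ncen; apply: contrapT => scal; apply: ncen; split=> // _ [a _ <-] M.
have /is_scalar_mxP[c ->] : is_scalar_mx (nceval 'M[F]_n.+2 f a).
  by apply: contrapT => /negP fa; apply: scal; exists a.
by rewrite /GRing.comm -!mulmxE scalar_mxC.
Qed.

Unset Implicit Arguments.

Theorem theorem1p1 (R : realType) (n : nat) (f : {ncpoly R[i]}) :
  let A := 'M[R[i]]_n.+2 in
  ~ nc_identity A f ->
  ~ nc_central A f ->
  forall B : A, \tr B = 0 ->
  exists B1 B2 : A,
    [/\ set_diff (ncimage A f) (ncimage A f) B1,
        set_diff (ncimage A f) (ncimage A f) B2
      & B = B1 + B2].
Proof.
move=> A nid ncen B trB.
have char0 : [pchar R[i]] =i pred0 := @Num.Theory.pchar_num R[i].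
have [a fa] := @noncentral_value R[i] n f nid ncen.
have [s [t [G [t0 mG fG]]]] := @nceval_small_multiplicity R[i] n f char0 a fa.
(* A similarity-invariant property; in differences of values [s] cancels, and [t] is absorbed by
   decomposing [t^-1 *: B]. *)
pose P (M : A) := exists a, nceval A f a = s%:M + t *: M.
have Psim M M' : similar_mx M M' -> P M -> P M'.
  case=> S uS SM [a' aM]; apply: (nceval_similar (a := a')).
  exists S => //; rewrite aM mulmxDr mulmxDl -scalemxAr SM scalemxAl.
  by rewrite scalar_mxC.
have trB' : \tr (t^-1 *: B) = 0 by rewrite mxtraceZ trB mulr0.
have [G1 [G2 [G3 [G4 [[a1 h1] [a2 h2] [a3 h3] [a4 h4] BE]]]]] :=
  trace0_decomposition char0 Psim fG mG trB'.
exists (t *: (G1 - G2)), (t *: (G3 - G4)); split.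
- exists (nceval A f a1); first by exists a1.
  exists (nceval A f a2); first by exists a2.
  by rewrite h1 h2 opprD addrACA subrr add0r scalerBr.
- exists (nceval A f a3); first by exists a3.
  exists (nceval A f a4); first by exists a4.
  by rewrite h3 h4 opprD addrACA subrr add0r scalerBr.
by rewrite -scalerDr -BE scalerA divff ?scale1r.
Qed.
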